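(* Let $k$ be a field with $\operatorname{char}(k)\neq 2$ and let $R=k[x,y]$. Let $G$ be the three-cycle with vertices $v_1,v_2,v_3$ in which the edge $v_1v_2$ has label $x^2$, the edge $v_2v_3$ has label $y^2$, and the edge $v_3v_1$ has label $(x+y)^2$. Then the module $R_G$ of generalized splines is free over $R$, but it does not have a flow-up class basis.
   Context: For a graph $G$ with ordered vertices $v_1,\dots,v_n$ and edges labeled by elements of a commutative ring $R$, a generalized spline on $G$ over $R$ is a tuple $(f_1,\dots,f_n)\in R^n$ such that whenever $v_i$ and $v_j$ are joined by an edge with label $a$, $f_i-f_j\in\langle a\rangle$. The set $R_G$ of all generalized splines is an $R$-submodule of $R^n$. For $0\le i<n$, the $i$th flow-up class $\mathcal{F}_i$ is the set of splines $F=(0,\dots,0,f_{i+1},\dots,f_n)\in R_G$ with exactly $i$ leading zeros, i.e. $f_1=\dots=f_i=0$ and $f_{i+1}\neq0$; also $\mathcal{F}_n=\{\mathbf{0}\}$. A flow-up class basis of $R_G$ is a module basis consisting of one element from each nonempty flow-up class other than $\mathcal{F}_n$. *)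

(* Defs.v *)
From HB Require Import structures.
From mathcomp Require Import all_boot all_order all_algebra.
From mathcomp Require Import mpoly.

Set Implicit Arguments.
Unset Strict Implicit.
Unset Printing Implicit Defensive.

Import GRing.Theory.
Local Open Scope ring_scope.

(* Subsets of a module are Prop-valued predicates, because membership in an
   ideal of an arbitrary commutative ring is not decidable. *)

Definition is_submodule (R : comNzRingType) (V : lmodType R) (S : V -> Prop) :
    Prop :=
  S 0 /\ forall (a : R) (u v : V), S u -> S v -> S (a *: u + v).

Definition linearly_independent (R : comNzRingType) (V : lmodType R)
    (B : V -> Prop) : Prop :=
  forall (s : seq V) (c : V -> R),
    uniq s -> (forall v, v \in s -> B v) ->
    \sum_(v <- s) c v *: v = 0 -> forall v, v \in s -> c v = 0.

Definition in_span (R : comNzRingType) (V : lmodType R) (B : V -> Prop)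
    (u : V) : Prop :=
  exists (s : seq V) (c : V -> R),
    (forall v, v \in s -> B v) /\ u = \sum_(v <- s) c v *: v.

(* A basis is a set of vectors, possibly infinite. *)
Definition is_basis (R : comNzRingType) (V : lmodType R) (S B : V -> Prop) :
    Prop :=
  [/\ forall v, B v -> S v, linearly_independent B
    & forall u, S u -> in_span B u].

Definition is_free_module (R : comNzRingType) (V : lmodType R)
    (S : V -> Prop) : Prop :=
  is_submodule S /\ exists B : V -> Prop, is_basis S B.

Definition in_principal_ideal (R : comNzRingType) (a z : R) : Prop :=
  exists q : R, z = q * a.

(* A finite simple graph on the ordered vertices 'I_n, with the edges as
   two-element sets; the value of the label outside the edges is irrelevant. *)
Record edge_labeled_graph (R : comNzRingType) (n : nat) := EdgeLabeledGraph {
  edges : {set {set 'I_n}};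
  edge_card : forall e, e \in edges -> #|e| = 2;
  label : {set 'I_n} -> R
}.

Definition spline (R : comNzRingType) (n : nat) (G : edge_labeled_graph R n)
    (f : 'rV[R]_n) : Prop :=
  forall i j : 'I_n, [set i; j] \in edges G ->
    in_principal_ideal (label G [set i; j]) (f 0 i - f 0 j).

Lemma spline_submodule (R : comNzRingType) (n : nat)
    (G : edge_labeled_graph R n) : is_submodule (spline G).
Proof.
split=> [i j _|a u v Su Sv i j eij].
  by exists 0; rewrite !mxE subrr mul0r.
have [p Ep] := Su _ _ eij; have [q Eq] := Sv _ _ eij.
exists (a * p + q).
by rewrite !mxE opprD addrACA -mulrBr Ep Eq mulrDl mulrA.
Qed.

(* Vertices are numbered from 0, so exactly i leading zeros means that the
   entries of index below i vanish and the entry of index i, if there is one,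
   does not; for i = n only the zero spline remains. *)
Definition flow_up_class (R : comNzRingType) (n : nat)
    (G : edge_labeled_graph R n) (i : nat) (f : 'rV[R]_n) : Prop :=
  [/\ spline G f, forall j : 'I_n, (j < i)%N -> f 0 j = 0
    & forall j : 'I_n, j = i :> nat -> f 0 j <> 0].

Definition flow_up_basis (R : comNzRingType) (n : nat)
    (G : edge_labeled_graph R n) (B : 'rV[R]_n -> Prop) : Prop :=
  [/\ is_basis (spline G) B,
      forall f, B f -> exists2 i : nat, (i < n)%N & flow_up_class G i f
    & forall i : nat, (i < n)%N -> (exists f, flow_up_class G i f) ->
        exists! f, B f /\ flow_up_class G i f].

Definition v1 : 'I_3 := @Ordinal 3 0 isT.
Definition v2 : 'I_3 := @Ordinal 3 1 isT.
Definition v3 : 'I_3 := @Ordinal 3 2 isT.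

Definition three_cycle_edges : {set {set 'I_3}} :=
  [set [set v1; v2]; [set v2; v3]; [set v3; v1]].

Lemma three_cycle_edge_card (e : {set 'I_3}) :
  e \in three_cycle_edges -> #|e| = 2.
Proof. by rewrite !inE => /orP[/orP[]|] /eqP->; rewrite cards2. Qed.

Definition three_cycle (R : comNzRingType) (l12 l23 l31 : R) :
    edge_labeled_graph R 3 :=
  EdgeLabeledGraph three_cycle_edge_card
    (fun e => if e == [set v1; v2] then l12
              else if e == [set v2; v3] then l23 else l31).

(* Main.v *)
Require Import Defs.
From HB Require Import structures.
From mathcomp Require Import all_boot all_order all_algebra.
From mathcomp Require Import mpoly.
From mathcomp Require Import ring.

Set Implicit Arguments.
Unset Strict Implicit.
Unset Printing Implicit Defensive.

Import GRing.Theory.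
Local Open Scope ring_scope.

(** Freeness.  A spline on the triangle is a constant spline plus a syzygy
    [a x^2 + b y^2 + c (x + y)^2 = 0] of the labels, read off from the three
    edge differences.  Modulo [x] the relation says that [x] divides [b + c],
    and modulo [y] that [y] divides [a + c]; substituting back gives
    [2 c = - (u x + w y)], so once 2 is invertible every syzygy is a
    combination of two linear ones ([syzygy_squares]).  With the constant
    spline [(1, 1, 1)] these give a basis of three splines
    ([spline_square_triangleP], [square_generators_independent]).

    No flow-up basis.  In a flow-up basis over a domain, the leading entry of
    the basis element of class [i] divides the entry of index [i] of every
    spline with [i] leading zeros ([flow_up_basis_leading_dvd]).  For [i = 1]
    all these entries are [x^2 A] where [A] runs over the combinations of
    [x + 2 y] and [y], that is, over the maximal ideal [(x, y)].  A flow-up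
    basis would thus make [(x, y)] principal, which it is not: a generator
    would vanish at the origin, and by the product rule the gradients of [x]
    and [y] at the origin would be proportional
    ([maximal_ideal_not_principal]). *)

(** * Bases *)

Lemma linearly_independent_seq (R : comNzRingType) (V : lmodType R)
    (t : seq V) :
  uniq t ->
  (forall c : V -> R, \sum_(v <- t) c v *: v = 0 ->
     forall v, v \in t -> c v = 0) ->
  linearly_independent (fun v => v \in t).
Proof.
move=> Ut Ht s c Us st; have Est: perm_eq s [seq v <- t | v \in s].
  apply: uniq_perm => // [|v]; first exact: filter_uniq.
  by rewrite mem_filter; case: (boolP (v \in s)) => // /st->.
rewrite (perm_big _ Est) /= big_filter big_mkcond => sum0 v sv.
suff: (if v \in s then c v else 0) = 0 by rewrite sv.
apply: (Ht (fun v => if v \in s then c v else 0)) (st v sv).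
by rewrite -[RHS]sum0; apply: eq_bigr => w _; case: ifP => // _;
rewrite scale0r.
Qed.

Lemma in_span_uniq (R : comNzRingType) (V : lmodType R) (B : V -> Prop) u :
  in_span B u -> exists (s : seq V) (c : V -> R),
    [/\ uniq s, forall v, v \in s -> B v & u = \sum_(v <- s) c v *: v].
Proof.
move=> [s [c [sB ->]]]; exists (undup s), (fun v => c v *+ count_mem v s).
split=> [|v|]; first exact: undup_uniq.
  by rewrite mem_undup; apply: sB.
rewrite -big_undup_iterop_count; apply: eq_bigr => v _.
by rewrite Monoid.iteropE iter_addr_0 scalerMnl.
Qed.

Lemma in_principal_idealD (R : comNzRingType) (a z1 z2 : R) :
  in_principal_ideal a z1 -> in_principal_ideal a z2 ->
  in_principal_ideal a (z1 + z2).
Proof. by move=> [p ->] [q ->]; exists (p + q); rewrite mulrDl. Qed.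

(** Expand [u] in the basis.  The basis elements of class below [i] have zero
    coefficient, by induction on the class [l]: at index [l] the lower classes
    contribute nothing and the higher ones vanish, so the only term left is
    the leading entry of the element of class [l].  Then only [b] contributes
    to the entry of index [i]. *)
Lemma flow_up_basis_leading_dvd (R : idomainType) (n : nat)
    (G : edge_labeled_graph R n) (B : 'rV[R]_n -> Prop) (i : 'I_n)
    (b u : 'rV[R]_n) :
  flow_up_basis G B -> B b -> flow_up_class G i b ->
  spline G u -> (forall j : 'I_n, (j < i)%N -> u 0 j = 0) ->
  in_principal_ideal (b 0 i) (u 0 i).
Proof.
move=> [[_ _ spanB] classB uniqB] Bb Fb Su u0.
have [s [c [Us sB Eu]]] := in_span_uniq (spanB u Su).
have same_class v w l : B v -> B w -> (l < n)%N ->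
    flow_up_class G l v -> flow_up_class G l w -> v = w.
  move=> Bv Bw ln Fv Fw.
  have [z [_ Uz]] := uniqB l ln (ex_intro _ v Fv).
  by rewrite -(Uz v) // -(Uz w).
have entry (j : 'I_n) : u 0 j = \sum_(v <- s) c v * v 0 j.
  by rewrite Eu summxE; apply: eq_bigr => v _; rewrite mxE.
have coef0 l v : (l < i)%N -> v \in s -> flow_up_class G l v -> c v = 0.
  elim/ltn_ind: l v => l IHl v li sv Fv.
  have ln : (l < n)%N := ltn_trans li (ltn_ord i).
  have [_ _ /(_ (Ordinal ln) erefl) /eqP vl] := Fv.
  have /esym/eqP := u0 (Ordinal ln) li; rewrite entry (bigD1_seq v) //=.
  rewrite big_seq_cond big1 => [|w /andP[sw wv]]; last first.
    have [m mn Fw] := classB w (sB w sw).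
    case: (ltngtP m l) => [ml|lm|ml].
    - by rewrite (IHl m ml w (ltn_trans ml li) sw Fw) mul0r.
    - by have [_ -> //] := Fw; rewrite mulr0.
    - rewrite ml in Fw; case/eqP: wv.
      exact: same_class (sB w sw) (sB v sv) ln Fw Fv.
  by rewrite addr0 eq_sym mulf_eq0 (negPf vl) orbF => /eqP.
rewrite entry big_seq; apply: big_ind => [||v sv].
- by exists 0; rewrite mul0r.
- exact: in_principal_idealD.
have [m mn Fv] := classB v (sB v sv).
case: (ltngtP m i) => [mi|im|mi].
- by exists 0; rewrite (coef0 m) // !mul0r.
- by have [_ -> //] := Fv; exists 0; rewrite mulr0 mul0r.
- rewrite mi in Fv; exists (c v).
  by rewrite (same_class v b i (sB v sv) Bb (ltn_ord i) Fv Fb).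
Qed.

(** * Splines on the triangle *)

Lemma set2_inj (T : finType) (i j a b : T) :
  [set i; j] = [set a; b] -> a != b -> (i = a /\ j = b) \/ (i = b /\ j = a).
Proof.
move=> E ab; have: a \in [set i; j] by rewrite E set21.
have: b \in [set i; j] by rewrite E set22.
rewrite !inE => /orP[]/eqP Eb /orP[]/eqP Ea; subst; auto; by rewrite eqxx in ab.
Qed.

Lemma in_principal_ideal_subC (R : comNzRingType) (a z1 z2 : R) :
  in_principal_ideal a (z1 - z2) -> in_principal_ideal a (z2 - z1).
Proof. by move=> [q E]; exists (- q); rewrite mulNr -E opprB. Qed.

Lemma spline_three_cycleP (R : comNzRingType) (l12 l23 l31 : R)
    (f : 'rV[R]_3) :
  spline (three_cycle l12 l23 l31) f <->
  [/\ in_principal_ideal l12 (f 0 v1 - f 0 v2),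
      in_principal_ideal l23 (f 0 v2 - f 0 v3)
    & in_principal_ideal l31 (f 0 v3 - f 0 v1)].
Proof.
have E23 : ([set v2; v3] == [set v1; v2]) = false.
  by apply/eqP=> /setP/(_ v1); rewrite !inE.
have E31 : ([set v3; v1] == [set v1; v2]) = false.
  by apply/eqP=> /setP/(_ v2); rewrite !inE.
have E31' : ([set v3; v1] == [set v2; v3]) = false.
  by apply/eqP=> /setP/(_ v2); rewrite !inE.
split=> [Sf|[S12 S23 S31] i j].
  split; [have := Sf v1 v2|have := Sf v2 v3|have := Sf v3 v1];
    by rewrite /= ?E31' ?E23 ?E31 !inE !eqxx ?orbT; apply.
rewrite /= !inE => /orP[/orP[]|] /eqP E; rewrite E ?eqxx ?E23 ?E31 ?E31';
  have [[-> ->]|[-> ->]] := set2_inj E isT;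
  by [|apply: in_principal_ideal_subC].
Qed.

Definition row3 (R : comNzRingType) (a b c : R) : 'rV[R]_3 :=
  \row_(j < 3) nth 0 [:: a; b; c] j.

Lemma row3E (R : comNzRingType) (a b c : R) :
  (row3 a b c 0 v1 = a) * (row3 a b c 0 v2 = b) * (row3 a b c 0 v3 = c).
Proof. by rewrite !mxE. Qed.

Lemma row3_eta (R : comNzRingType) (f : 'rV[R]_3) :
  f = row3 (f 0 v1) (f 0 v2) (f 0 v3).
Proof.
apply/rowP=> -[[|[|[|//]]] lt_j]; rewrite !mxE /=;
  congr (f _ _); exact: val_inj.
Qed.

(** * Variables in a polynomial ring *)

Lemma mpolyXU_dvd (n : nat) (R : comNzRingType) (i : 'I_n)
    (p : {mpoly R[n]}) :
  (forall m : 'X_{1..n}, m i = 0%N -> p@_m = 0) ->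
  in_principal_ideal 'X_i p.
Proof.
move=> p0; rewrite (mpolyE p) big_seq; apply: big_ind => [||m].
- by exists 0; rewrite mul0r.
- exact: in_principal_idealD.
rewrite mcoeff_msupp => pm; have mi : (U_(i) <= m)%MM.
  by rewrite lep1mP; apply: contraNneq pm => /p0->.
exists (p@_m *: 'X_[m - U_(i)]).
by rewrite -scalerAl -mpolyXD submK.
Qed.

(** Multiplication by a power of ['X_i] sends the terms of [c] free of ['X_j]
    to distinct terms with the same coefficients, still free of ['X_j]; a
    multiple of ['X_j] has no such terms. *)
Lemma mpolyXU_dvd_mulXn (n : nat) (R : comNzRingType) (i j : 'I_n) (e : nat)
    (c : {mpoly R[n]}) :
  i != j -> in_principal_ideal 'X_j (c * 'X_i ^+ e) ->
  in_principal_ideal 'X_j c.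
Proof.
move=> ij [d Ed]; apply: mpolyXU_dvd => m mj.
rewrite -(mcoeffMX c (U_(i) *+ e) m) -mpolyXn Ed mulrC.
rewrite mcoeffM big1 // => k /eqP Ek.
rewrite mcoeffX; case: eqP => [Uk|_]; last by rewrite ?mul0r ?mulr0.
have := congr1 (fun m : 'X_{1..n} => m j) Ek.
rewrite !mnmDE mulmnE mnm1E (negPf ij) mul0n mj -Uk mnm1E eqxx.
by rewrite ?addn1 ?add1n.
Qed.

(** If ['X_i = p A] with [A] zero at the origin, the product rule there says
    that the gradient of ['X_i] is [p(0)] times that of [A].  The partial
    derivative of [A] along [j] would have to vanish because of ['X_i], and
    not to vanish because of ['X_j]. *)
Lemma maximal_ideal_not_principal (n : nat) (R : idomainType) (i j : 'I_n)
    (A : {mpoly R[n]}) :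
  i != j -> A.@[fun=> 0] = 0 ->
  in_principal_ideal A 'X_i -> in_principal_ideal A 'X_j -> False.
Proof.
move=> ij A0 [p Ep] [q Eq].
have grad l m (d : {mpoly R[n]}) : 'X_l = d * A ->
    (l == m)%:R = d.@[fun=> 0] * (A^`M(m)).@[fun=> 0].
  move=> E; have := congr1 (fun f => (f^`M(m)).@[fun=> 0]) E.
  rewrite mderivM mevalD !mevalM A0 mulr0 add0r => <-.
  rewrite mderivX mevalZ mnm1E; case: eqVneq => [->|_]; last by rewrite mul0r.
  by rewrite -{1}[U_(m)%MM]add0m addmK mpolyX0 meval1 mulr1.
have /eqP := grad i j p Ep; rewrite (negPf ij) eq_sym mulf_eq0 => /orP[]/eqP E0.
  by have /eqP := grad i i p Ep; rewrite eqxx E0 mul0r oner_eq0.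
by have /eqP := grad j j q Eq; rewrite eqxx E0 mulr0 oner_eq0.
Qed.

(** * The triangle with labels x^2, y^2, (x + y)^2 *)

Section SquareTriangle.

Variable k : fieldType.
Hypothesis hchar : 2%N \notin [pchar k].

Let x : {mpoly k[2]} := 'X_ord0.
Let y : {mpoly k[2]} := 'X_ord_max.
Let G := three_cycle (x ^+ 2) (y ^+ 2) ((x + y) ^+ 2).

Lemma two_half : (2^-1%:MP * 2%:R : {mpoly k[2]}) = 1.
Proof.
have -> : 2%:R = 2%:R%:MP :> {mpoly k[2]} by rewrite rmorph_nat.
by rewrite -mpolyCM mulVf.
Qed.

Lemma x_neq0 : x != 0. Proof. by rewrite -msupp_eq0 msuppX. Qed.

Lemma y_neq0 : y != 0. Proof. by rewrite -msupp_eq0 msuppX. Qed.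

Lemma xDy_neq0 : x + y != 0.
Proof.
apply/eqP=> /(congr1 (mcoeff U_(ord0)))/eqP.
by rewrite mcoeffD !mcoeffXU mcoeff0 addr0 oner_eq0.
Qed.

(** Modulo [x] and modulo [y] the relation gives [b + c = w x] and
    [a + c = u y].  Putting these back and cancelling [x y] leaves
    [u x + w y + 2 c = 0], so [p] and [q] are [- u / 2] and [- w / 2]. *)
Lemma syzygy_squares (a b c : {mpoly k[2]}) :
  a * x ^+ 2 + b * y ^+ 2 + c * (x + y) ^+ 2 = 0 ->
  exists p q, a = - (p * (x + 2%:R * y) + q * y) /\ c = p * x + q * y.
Proof.
move=> E.
have [u Eu] : in_principal_ideal y (a + c).
  apply: (@mpolyXU_dvd_mulXn _ _ ord0 _ 2) => //.
  exists (- (b * y + c * (2%:R * x + y))).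
  by apply/eqP; rewrite -/x -/y -subr_eq0 -[X in _ == X]E; apply/eqP; ring.
have [w Ew] : in_principal_ideal x (b + c).
  apply: (@mpolyXU_dvd_mulXn _ _ ord_max _ 2) => //.
  exists (- (a * x + c * (x + 2%:R * y))).
  by apply/eqP; rewrite -/x -/y -subr_eq0 -[X in _ == X]E; apply/eqP; ring.
have Ea : a = u * y - c by rewrite -Eu addrK.
have Eb : b = w * x - c by rewrite -Ew addrK.
have E2c : u * x + w * y + 2%:R * c = 0.
  apply: (mulIf (mulf_neq0 x_neq0 y_neq0)).
  by rewrite mul0r -[RHS]E Ea Eb; ring.
set h : {mpoly k[2]} := 2^-1%:MP; have h2 : h * 2%:R = 1 := two_half.
have Ec : c = - (h * u) * x + - (h * w) * y.
  transitivity (h * 2%:R * c - h * (u * x + w * y + 2%:R * c)); last by ring.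
  by rewrite E2c h2 mul1r mulr0 subr0.
exists (- (h * u)), (- (h * w)); split=> //.
transitivity (h * 2%:R * (u * y) - c); first by rewrite h2 mul1r.
by rewrite Ec; ring.
Qed.

(** The second and third splines come from the syzygies
    [(- (x + 2 y), - x, x)] and [(- y, - (2 x + y), y)]: the first entry is
    [0] and the differences along the edges [v1 v2], [v2 v3], [v3 v1] are the
    three terms of the syzygy. *)
Definition square_generators : seq 'rV[{mpoly k[2]}]_3 :=
  [:: row3 1 1 1;
      row3 0 ((x + 2%:R * y) * x ^+ 2) (x * (x + y) ^+ 2);
      row3 0 (y * x ^+ 2) (y * (x + y) ^+ 2)].

Definition square_combination (r p q : {mpoly k[2]}) : 'rV[{mpoly k[2]}]_3 :=
  row3 r (r + (p * (x + 2%:R * y) + q * y) * x ^+ 2)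
         (r + (p * x + q * y) * (x + y) ^+ 2).

Lemma sum_square_generators (c : 'rV[{mpoly k[2]}]_3 -> {mpoly k[2]}) :
  \sum_(v <- square_generators) c v *: v =
  square_combination (c (nth 0 square_generators 0))
    (c (nth 0 square_generators 1)) (c (nth 0 square_generators 2)).
Proof.
rewrite /square_generators !big_cons big_nil /=.
move: (c _) (c _) (c _) => r p q; rewrite [LHS]row3_eta.
by congr row3; rewrite !mxE /=; ring.
Qed.

Lemma spline_square_triangleP f :
  spline G f <-> exists r p q, f = square_combination r p q.
Proof.
split=> [/spline_three_cycleP[[a Ea] [b Eb] [c Ec]]|[r [p [q ->]]]].
  have [|p [q [Ep Eq]]] := @syzygy_squares a b c.
    by rewrite -Ea -Eb -Ec; ring.
  exists (f 0 v1), p, q; rewrite [LHS]row3_eta; congr row3; apply/eqP.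
    by rewrite eq_sym -subr_eq0 -subr_eq0 -[p * _ + _]opprK -Ep mulNr -Ea;
       apply/eqP; ring.
  by rewrite addrC -subr_eq Ec Eq.
apply/spline_three_cycleP; rewrite !row3E; split.
- by exists (- (p * (x + 2%:R * y) + q * y)); ring.
- by exists (- (p * x + q * (2%:R * x + y))); ring.
- by exists (p * x + q * y); ring.
Qed.

Lemma square_combination_eq0 r p q :
  square_combination r p q = 0 -> [/\ r = 0, p = 0 & q = 0].
Proof.
move=> E; have entry j := congr1 (fun f : 'rV_3 => f 0 j) E.
have := entry v1; have /eqP := entry v2; have /eqP := entry v3.
rewrite /square_combination !row3E !mxE => E3 E2 r0; move: E2 E3.
rewrite r0 !add0r (mulf_eq0 _ (x ^+ 2)) (mulf_eq0 _ ((x + y) ^+ 2)).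
rewrite (negPf (expf_neq0 2 x_neq0)) (negPf (expf_neq0 2 xDy_neq0)) !orbF.
move=> /eqP E2 /eqP E3; have p0 : p = 0.
  apply: (mulIf y_neq0); rewrite mul0r -[LHS]mul1r -two_half.
  transitivity (2^-1%:MP * (p * (x + 2%:R * y) + q * y - (p * x + q * y))).
    by ring.
  by rewrite E2 E3 subr0 mulr0.
by split=> //; apply: (mulIf y_neq0); rewrite mul0r -E3 p0 mul0r add0r.
Qed.

Lemma square_generators_uniq : uniq square_generators.
Proof.
rewrite /= !inE !negb_or andbT -!andbA.
apply/and3P; split; apply/eqP=> E;
  have entry j := congr1 (fun f : 'rV_3 => f 0 j) E.
- by have /eqP := entry v1; rewrite !row3E oner_eq0.
- by have /eqP := entry v1; rewrite !row3E oner_eq0.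
- have := entry v2; rewrite !row3E => /(mulIf (expf_neq0 2 x_neq0)) Exy.
  case/eqP: xDy_neq0; transitivity (x + 2%:R * y - y); first by ring.
  by rewrite Exy subrr.
Qed.

Lemma square_generators_independent :
  linearly_independent (fun v => v \in square_generators).
Proof.
apply: linearly_independent_seq square_generators_uniq _ => c.
rewrite sum_square_generators => /square_combination_eq0[r0 p0 q0] v.
by rewrite !inE => /or3P[] /eqP->.
Qed.

Lemma square_triangle_free : is_free_module (spline G).
Proof.
split; first exact: spline_submodule.
exists (fun v => v \in square_generators); split=> [v sv||f].
- apply/spline_square_triangleP; move: sv.
  rewrite !inE => /or3P[] /eqP->;
    [exists 1, 0, 0 | exists 0, 1, 0 | exists 0, 0, 1];
    by congr row3; ring.
- exact: square_generators_independent.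
move=> /spline_square_triangleP[r [p [q ->]]].
exists square_generators,
  (fun v => nth 0 [:: r; p; q] (index v square_generators)).
split=> //; rewrite sum_square_generators.
by rewrite !index_uniq //; apply: square_generators_uniq.
Qed.

(** The entry at [v2] of a spline vanishing at [v1] is [x^2] times an arbitrary
    combination of [x + 2 y] and [y].  The basis element of class [1] has such
    an entry [x^2 A], and it divides the entries [x^2 x] and [x^2 y]. *)
Lemma square_triangle_no_flow_up_basis B : ~ flow_up_basis G B.
Proof.
move=> basisB.
have lead0 (f : 'rV[{mpoly k[2]}]_3) : f 0 v1 = 0 ->
    forall j : 'I_3, (j < v2)%N -> f 0 j = 0.
  by move=> f0 j; rewrite ltnS leqn0 => /eqP j0;
     rewrite (_ : j = v1) //; apply: val_inj.
have splineP p q : spline G (square_combination 0 p q).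
  by apply/spline_square_triangleP; exists 0, p, q.
have F1 : flow_up_class G v2 (square_combination 0 0 1).
  split=> [||j j2]; [exact: splineP|by apply: lead0; rewrite row3E|].
  rewrite (_ : j = v2); last exact: val_inj.
  apply/eqP; rewrite row3E add0r mul0r add0r mul1r.
  by rewrite mulf_neq0 ?expf_neq0 ?x_neq0 ?y_neq0.
have [_ _ /(_ v2 isT (ex_intro _ _ F1)) [b [[Bb Fb] _]]] := basisB.
have [/spline_square_triangleP[r [p [q Eb]]] b0 _] := Fb.
have r0 : r = 0 by have := b0 v1 isT; rewrite Eb row3E.
set A := p * (x + 2%:R * y) + q * y.
have b2 : b 0 v2 = A * x ^+ 2 by rewrite Eb row3E r0 add0r.
have A_dvd p' q' : in_principal_ideal A (p' * (x + 2%:R * y) + q' * y).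
  have [|d] := flow_up_basis_leading_dvd basisB Bb Fb (splineP p' q').
    by apply: lead0; rewrite row3E.
  rewrite row3E add0r b2 (mulrA d) => /(mulIf (expf_neq0 2 x_neq0)) Ed.
  by exists d.
apply: (@maximal_ideal_not_principal _ _ ord0 ord_max A) => //.
- by rewrite !(mevalD, mevalM) !mevalXU !(mulr0, addr0).
- by have := A_dvd 1 (- 2%:R); congr in_principal_ideal; rewrite -/x; ring.
- by have := A_dvd 0 1; rewrite mul0r add0r mul1r.
Qed.

End SquareTriangle.

Theorem proposition5p2 (k : fieldType) (hchar : 2%N \notin [pchar k]) :
  let x : {mpoly k[2]} := 'X_ord0 in
  let y : {mpoly k[2]} := 'X_ord_max in
  let G := three_cycle (x ^+ 2) (y ^+ 2) ((x + y) ^+ 2) in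
  is_free_module (spline G) /\
  ~ (exists B : 'rV[{mpoly k[2]}]_3 -> Prop, flow_up_basis G B).
Proof.
split; first exact: square_triangle_free.
by move=> [B]; apply: square_triangle_no_flow_up_basis.
Qed.
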